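(* Consider the 2D high-order scheme for cell averages $$\bar{\mathbf U}_{ij}^{n+1}=\bar{\mathbf U}_{ij}^n-\frac{\Delta t_n}{\Delta x}\sum_{\mu=1}^Q\omega_\mu\Big(\hat{\mathbf F}_1(\mathbf U_{i+\frac12,j}^{-,\mu},\mathbf U_{i+\frac12,j}^{+,\mu})-\hat{\mathbf F}_1(\mathbf U_{i-\frac12,j}^{-,\mu},\mathbf U_{i-\frac12,j}^{+,\mu})\Big)-\frac{\Delta t_n}{\Delta y}\sum_{\mu=1}^Q\omega_\mu\Big(\hat{\mathbf F}_2(\mathbf U_{i,j+\frac12}^{\mu,-},\mathbf U_{i,j+\frac12}^{\mu,+})-\hat{\mathbf F}_2(\mathbf U_{i,j-\frac12}^{\mu,-},\mathbf U_{i,j-\frac12}^{\mu,+})\Big),$$ built from polynomial vectors $\mathbf U_{ij}^n(x,y)$ as described in the context. If the polynomial vectors $\{\mathbf U_{ij}^n(x,y)\}$ satisfy $$\mathrm{div}_{ij}\mathbf B^n=0\quad\forall i,j,$$ $$\mathbf U_{ij}^n(\hat x_i^{(\nu)},y_j^{(\mu)}),\ \mathbf U_{ij}^n(x_i^{(\mu)},\hat y_j^{(\nu)})\in\mathcal G\quad\forall i,j,\mu,\nu,$$ then the scheme always preserves $\bar{\mathbf U}_{ij}^{n+1}\in\mathcal G$ under the CFL condition $$0<\frac{\alpha_{1,n}^{LF}\Delta t_n}{\Delta x}+\frac{\alpha_{2,n}^{LF}\Delta t_n}{\Delta y}\le\hat\omega_1,$$ where the parameters satisfy $$\alpha_{1,n}^{LF}>\max_{i,j,\mu}\alpha_1\big(\mathbf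 U_{i+\frac12,j}^{\pm,\mu},\mathbf U_{i-\frac12,j}^{\pm,\mu}\big),\qquad \alpha_{2,n}^{LF}>\max_{i,j,\mu}\alpha_2\big(\mathbf U_{i,j+\frac12}^{\mu,\pm},\mathbf U_{i,j-\frac12}^{\mu,\pm}\big)$$ (for both choices of sign, the same sign in both arguments).
   Context: States and physics. A state is $\mathbf U=(\rho,\mathbf m,\mathbf B,E)^\top\in\mathbb R^8$ with $\rho,E\in\mathbb R$, $\mathbf m,\mathbf B\in\mathbb R^3$. For $\rho>0$ put $\mathbf v=\mathbf m/\rho$, $\mathcal E(\mathbf U)=E-\frac12\big(\frac{|\mathbf m|^2}{\rho}+|\mathbf B|^2\big)$, $e=\mathcal E(\mathbf U)/\rho$, $p=p(\rho,e)$, $p_{tot}=p+\frac{|\mathbf B|^2}{2}$. The equation of state $p(\rho,e)$ is any function such that, whenever $\rho>0$, one has $e>0\Leftrightarrow p(\rho,e)>0$. Admissible states: $\mathcal G=\{\mathbf U:\rho>0,\ \mathcal E(\mathbf U)>0\}$. Flux: $$\mathbf F_\ell(\mathbf U)=\big(\rho v_\ell,\ \rho v_\ell\mathbf v-B_\ell\mathbf B+p_{tot}\mathbf e_\ell,\ v_\ell\mathbf B-B_\ell\mathbf v,\ v_\ell(E+p_{tot})-B_\ell(\mathbf v\cdot\mathbf B)\big)^\top,$$ with $\mathbf e_\ell$ the $\ell$-th standard unit vector of $\mathbb R^3$. LF flux: $\hat{\mathbf F}_\ell(\mathbf U^-,\mathbf U^+)=\frac12\big(\mathbf F_\ell(\mathbf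 U^-)+\mathbf F_\ell(\mathbf U^+)-\alpha_{\ell,n}^{LF}(\mathbf U^+-\mathbf U^-)\big)$. For $\mathbf U,\tilde{\mathbf U}\in\mathcal G$, $\alpha_\ell(\mathbf U,\tilde{\mathbf U})=\min_{\sigma\in\mathbb R}\alpha_\ell(\mathbf U,\tilde{\mathbf U};\sigma)$ with $$\alpha_\ell(\mathbf U,\tilde{\mathbf U};\sigma)=\max\big\{|v_\ell|+\mathscr C_\ell,\ |\tilde v_\ell|+\tilde{\mathscr C}_\ell,\ |\sigma v_\ell+(1-\sigma)\tilde v_\ell|+\max\{\mathscr C_\ell,\tilde{\mathscr C}_\ell\}\big\}+\frac{|\tilde{\mathbf B}-\mathbf B|}{\sqrt2}\sqrt{\frac{\sigma^2}{\rho}+\frac{(1-\sigma)^2}{\tilde\rho}},$$ $$\mathscr C_\ell=\frac1{\sqrt2}\Big[\mathscr C_s^2+\frac{|\mathbf B|^2}{\rho}+\sqrt{\Big(\mathscr C_s^2+\frac{|\mathbf B|^2}{\rho}\Big)^2-4\frac{\mathscr C_s^2B_\ell^2}{\rho}}\Big]^{1/2},\qquad \mathscr C_s=\frac{p}{\rho\sqrt{2e}},$$ and $\tilde{\mathscr C}_\ell$ the same quantity for $\tilde{\mathbf U}$. Discretization. The mesh is uniform rectangular with cells $I_{ij}=(x_{i-\frac12},x_{i+\frac12})\times(y_{j-\frac12},y_{j+\frac12})$, spacings $\Delta x,\Delta y>0$, indices $(i,j)\in\mathbb Z^2$ (maxima over indices understood as suprema). $\mathbf U_{ij}^n(x,y)$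 is a polynomial vector of degree $K$ on $I_{ij}$ whose average over $I_{ij}$ is $\bar{\mathbf U}_{ij}^n$. $\{x_i^{(\mu)}\}_{\mu=1}^Q$ and $\{y_j^{(\mu)}\}_{\mu=1}^Q$ are the $Q$-point Gauss quadrature nodes in $[x_{i-\frac12},x_{i+\frac12}]$ and $[y_{j-\frac12},y_{j+\frac12}]$, with weights $\{\omega_\mu\}$, $\sum_\mu\omega_\mu=1$, and $Q\ge(K+1)/2$ for finite volume schemes or $Q\ge K+1$ for discontinuous Galerkin schemes (so the rule is exact for degree $K$). $\{\hat x_i^{(\nu)}\}_{\nu=1}^L$ and $\{\hat y_j^{(\nu)}\}_{\nu=1}^L$ are the $L$-point Gauss–Lobatto nodes (including endpoints) in the same intervals, with weights $\{\hat\omega_\nu\}$, $\sum_\nu\hat\omega_\nu=1$, $L\ge\frac{K+3}2$ (exact for degree $K$). The limiting values are $$\mathbf U_{i+\frac12,j}^{-,\mu}=\mathbf U_{ij}^n(x_{i+\frac12},y_j^{(\mu)}),\quad \mathbf U_{i-\frac12,j}^{+,\mu}=\mathbf U_{ij}^n(x_{i-\frac12},y_j^{(\mu)}),\quad \mathbf U_{i,j+\frac12}^{\mu,-}=\mathbf U_{ij}^n(x_i^{(\mu)},y_{j+\frac12}),\quad \mathbf U_{i,j-\frac12}^{\mu,+}=\mathbf U_{ij}^n(x_i^{(\mu)},y_{j-\frac12}).$$ The discrete divergence is $$\mathrm{div}_{ij}\mathbf B^n:=\frac{\sum_{\mu=1}^Q\omega_\mu\big(\overline{(B_1)}_{i+\frac12,j}^\mu-\overline{(B_1)}_{i-\frac12,j}^\mu\big)}{\Delta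 x}+\frac{\sum_{\mu=1}^Q\omega_\mu\big(\overline{(B_2)}_{i,j+\frac12}^\mu-\overline{(B_2)}_{i,j-\frac12}^\mu\big)}{\Delta y},$$ where $\overline{(B_1)}_{i+\frac12,j}^\mu=\frac12\big((B_1)_{i+\frac12,j}^{-,\mu}+(B_1)_{i+\frac12,j}^{+,\mu}\big)$ and $\overline{(B_2)}_{i,j+\frac12}^\mu=\frac12\big((B_2)_{i,j+\frac12}^{\mu,-}+(B_2)_{i,j+\frac12}^{\mu,+}\big)$. *)

(* Defs.v *)
From HB Require Import structures.
From mathcomp Require Import all_boot all_order all_algebra.
From mathcomp Require Import all_classical all_reals all_analysis.

Set Implicit Arguments.
Unset Strict Implicit.
Unset Printing Implicit Defensive.

Import Order.TTheory GRing.Theory Num.Theory.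

Local Open Scope classical_set_scope.
Local Open Scope ring_scope.

Section Physics.
Variable R : realType.

(* 1 + (3 + (3 + 1)) is convertible to 8; the block form splits a state into
   (rho, m, B, E). *)
Definition state := 'rV[R]_(1 + (3 + (3 + 1))).

Definition mk_state (rho : R) (m B : 'rV[R]_3) (E : R) : state :=
  row_mx (const_mx rho) (row_mx m (row_mx B (const_mx E))).

Definition density (U : state) : R := lsubmx U 0 0.
Definition momentum (U : state) : 'rV[R]_3 := lsubmx (rsubmx U).
Definition magnetic (U : state) : 'rV[R]_3 := lsubmx (rsubmx (rsubmx U)).
Definition energy (U : state) : R := rsubmx (rsubmx (rsubmx U)) 0 0.

(* Euclidean structure on R^3; MathComp-Analysis' norm on matrices is the
   sup norm. *)
Definition dot (u v : 'rV[R]_3) : R := \sum_(k < 3) u 0 k * v 0 k.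
Definition enorm (u : 'rV[R]_3) : R := Num.sqrt (dot u u).

Definition velocity (U : state) : 'rV[R]_3 := (density U)^-1 *: momentum U.

Definition internal_energy (U : state) : R :=
  energy U - (enorm (momentum U) ^+ 2 / density U + enorm (magnetic U) ^+ 2) / 2.

Definition specific_internal_energy (U : state) : R :=
  internal_energy U / density U.

Definition admissible (U : state) : Prop :=
  0 < density U /\ 0 < internal_energy U.

Definition equation_of_state (p : R -> R -> R) : Prop :=
  forall rho e : R, 0 < rho -> (0 < e <-> 0 < p rho e).

Definition pressure (p : R -> R -> R) (U : state) : R :=
  p (density U) (specific_internal_energy U).

Definition total_pressure (p : R -> R -> R) (U : state) : R :=
  pressure p U + enorm (magnetic U) ^+ 2 / 2.

Definition flux (p : R -> R -> R) (l : 'I_3) (U : state) : state :=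
  let rho := density U in
  let v := velocity U in
  let B := magnetic U in
  let ptot := total_pressure p U in
  mk_state (rho * v 0 l)
           ((rho * v 0 l) *: v - B 0 l *: B + ptot *: delta_mx 0 l)
           (v 0 l *: B - B 0 l *: v)
           (v 0 l * (energy U + ptot) - B 0 l * dot v B).

Definition lf_flux (p : R -> R -> R) (l : 'I_3) (a : R) (Um Up : state) : state :=
  2^-1 *: (flux p l Um + flux p l Up - a *: (Up - Um)).

Definition cs_speed (p : R -> R -> R) (U : state) : R :=
  pressure p U / (density U * Num.sqrt (2 * specific_internal_energy U)).

Definition c_speed (p : R -> R -> R) (l : 'I_3) (U : state) : R :=
  let cs2 := cs_speed p U ^+ 2 in
  let s := cs2 + enorm (magnetic U) ^+ 2 / density U in
  (Num.sqrt 2)^-1 *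
    Num.sqrt (s + Num.sqrt (s ^+ 2 - 4 * (cs2 * magnetic U 0 l ^+ 2 / density U))).

Definition alpha_sigma (p : R -> R -> R) (l : 'I_3) (U W : state) (sigma : R) : R :=
  let vU := velocity U 0 l in
  let vW := velocity W 0 l in
  let cU := c_speed p l U in
  let cW := c_speed p l W in
  Num.max (Num.max (`|vU| + cU) (`|vW| + cW))
          (`|sigma * vU + (1 - sigma) * vW| + Num.max cU cW)
  + enorm (magnetic W - magnetic U) / Num.sqrt 2 *
    Num.sqrt (sigma ^+ 2 / density U + (1 - sigma) ^+ 2 / density W).

(* For admissible U and W, alpha_sigma is continuous in sigma, and it is constant
   or tends to +oo at both ends, so the infimum is a minimum. *)
Definition alpha (p : R -> R -> R) (l : 'I_3) (U W : state) : R :=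
  inf (range (alpha_sigma p l U W)).

End Physics.

Section Quadrature.
Variable R : realType.
Local Notation mu := (@lebesgue_measure R).

Definition average (a b : R) (f : R -> R) : R :=
  (b - a)^-1 * \int[mu]_(x in `[a, b]) f x.

(* Gauss and Gauss-Lobatto rules are determined by their degree of exactness,
   2n-1 and 2n-3 respectively; the nodes are listed in increasing order. The
   weights are normalized by the length of the interval, so exactness on
   constants says that they sum to 1. *)
Definition gauss_rule (n : nat) (a b : R) (x w : 'I_n -> R) : Prop :=
  [/\ forall k l : 'I_n, (k < l)%N -> x k < x l,
      forall k, a <= x k <= b
    & forall q : {poly R}, (size q <= 2 * n)%N ->
        average a b (fun t => q.[t]) = \sum_(k < n) w k * q.[x k]].

Definition gauss_lobatto_rule (n : nat) (a b : R) (x w : 'I_n -> R) : Prop :=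
  [/\ forall k l : 'I_n, (k < l)%N -> x k < x l,
      forall k, a <= x k <= b,
      (exists k, x k = a) /\ (exists k, x k = b)
    & forall q : {poly R}, (size q <= 2 * n - 2)%N ->
        average a b (fun t => q.[t]) = \sum_(k < n) w k * q.[x k]].

End Quadrature.

Section Discretization.
Variable R : realType.
Local Notation mu := (@lebesgue_measure R).

(* A bivariate polynomial q(x,y) has x as its outer variable: q.[x, y] is its
   value and q`_a`_b is the coefficient of x^a y^b. *)
Definition poly_state := 'rV[{poly {poly R}}]_(1 + (3 + (3 + 1))).

Definition degree_le (K : nat) (q : {poly {poly R}}) : Prop :=
  forall a b : nat, (K < a + b)%N -> q`_a`_b = 0.

Definition eval_state (P : poly_state) (x y : R) : state R :=
  map_mx (fun q : {poly {poly R}} => q.[x, y]) P.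

Definition cell_average (P : poly_state) (a b c d : R) : state R :=
  map_mx (fun q : {poly {poly R}} =>
    ((b - a) * (d - c))^-1 *
    \int[(mu \x mu)%E]_(z in `]a, b[ `*` `]c, d[) q.[z.1, z.2]) P.

(* Half-integer indices are shifted down: xf i stands for x_{i+1/2}, so that
   cell (i,j) is ]xf (i-1), xf i[ x ]yf (j-1), yf j[, and trace_x_minus at
   (i,j,k) stands for U^{-,k}_{i+1/2,j}; similarly for the other traces. *)
Definition trace_x_minus (Q : nat) (P : int -> int -> poly_state)
    (xf : int -> R) (yg : int -> 'I_Q -> R) (i j : int) (k : 'I_Q) : state R :=
  eval_state (P i j) (xf i) (yg j k).

Definition trace_x_plus (Q : nat) (P : int -> int -> poly_state)
    (xf : int -> R) (yg : int -> 'I_Q -> R) (i j : int) (k : 'I_Q) : state R :=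
  eval_state (P (i + 1) j) (xf i) (yg j k).

Definition trace_y_minus (Q : nat) (P : int -> int -> poly_state)
    (yf : int -> R) (xg : int -> 'I_Q -> R) (i j : int) (k : 'I_Q) : state R :=
  eval_state (P i j) (xg i k) (yf j).

Definition trace_y_plus (Q : nat) (P : int -> int -> poly_state)
    (yf : int -> R) (xg : int -> 'I_Q -> R) (i j : int) (k : 'I_Q) : state R :=
  eval_state (P i (j + 1)) (xg i k) (yf j).

Definition mean_B (l : 'I_3) (Um Up : state R) : R :=
  (magnetic Um 0 l + magnetic Up 0 l) / 2.

Definition discrete_div (Q : nat) (dx dy : R) (w : 'I_Q -> R)
    (Uxm Uxp Uym Uyp : int -> int -> 'I_Q -> state R) (i j : int) : R :=
  (\sum_(k < Q) w k * (mean_B 0 (Uxm i j k) (Uxp i j k)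
                       - mean_B 0 (Uxm (i - 1) j k) (Uxp (i - 1) j k))) / dx
  + (\sum_(k < Q) w k * (mean_B 1 (Uym i j k) (Uyp i j k)
                         - mean_B 1 (Uym i (j - 1) k) (Uyp i (j - 1) k))) / dy.

Definition next_average (p : R -> R -> R) (Q : nat) (dt dx dy a1 a2 : R)
    (w : 'I_Q -> R) (Ubar : int -> int -> state R)
    (Uxm Uxp Uym Uyp : int -> int -> 'I_Q -> state R) (i j : int) : state R :=
  Ubar i j
  - (dt / dx) *: (\sum_(k < Q) w k *:
      (lf_flux p 0 a1 (Uxm i j k) (Uxp i j k)
       - lf_flux p 0 a1 (Uxm (i - 1) j k) (Uxp (i - 1) j k)))
  - (dt / dy) *: (\sum_(k < Q) w k *:
      (lf_flux p 1 a2 (Uym i j k) (Uyp i j k)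
       - lf_flux p 1 a2 (Uym i (j - 1) k) (Uyp i (j - 1) k))).

(* Suprema are taken in the extended reals, so that "< a%:E" entails that the
   family of speeds is bounded above. *)
Definition sup_alpha_x (p : R -> R -> R) (Q : nat)
    (V : int -> int -> 'I_Q -> state R) : \bar R :=
  ereal_sup (range (fun t : int * int * 'I_Q =>
    (alpha p 0 (V t.1.1 t.1.2 t.2) (V (t.1.1 - 1) t.1.2 t.2))%:E)).

Definition sup_alpha_y (p : R -> R -> R) (Q : nat)
    (V : int -> int -> 'I_Q -> state R) : \bar R :=
  ereal_sup (range (fun t : int * int * 'I_Q =>
    (alpha p 1 (V t.1.1 t.1.2 t.2) (V t.1.1 (t.1.2 - 1) t.2))%:E)).

End Discretization.

(* Main.v *)
Require Import Defs.
From HB Require Import structures.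
From mathcomp Require Import all_boot all_order all_algebra ring lra zify.
From mathcomp Require Import all_classical all_reals all_analysis.
From mathcomp Require Import measurable_realfun.
Set Implicit Arguments.
Unset Strict Implicit.
Unset Printing Implicit Defensive.
Import Order.TTheory GRing.Theory Num.Theory.
Import numFieldNormedType.Exports.
Local Open Scope classical_set_scope.
Local Open Scope ring_scope.

(** Admissibility is convex but not linear: the internal energy is a nonlinear function
    of the state. It becomes linear by duality. For [v] and [B] in 3-space, the affine
    function [energy_form v B U + |B|^2 / 2] equals the internal energy of [U] plus
    the nonnegative terms [rho |v(U) - v|^2 / 2] and [|B(U) - B|^2 / 2]; so it is positive on
    admissible states, and it is the internal energy when [v = v(U)] and [B = B(U)].
    It therefore suffices to show that the density, and each of these affine functions,
    stays positive under the scheme.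

    The heart of the matter is a splitting inequality for two admissible states [U] and
    [W] ([density_flux_splitting], [energy_flux_splitting]): when [a > alpha_l(U, W)],
    the sum of [U - F(U)/a] and [W + F(W)/a] is positive for such an affine function,
    except for a defect proportional to the jump [B_l(U) - B_l(W)], with a factor
    [v . B] that does not depend on the states. The estimate rests on an exact
    decomposition of the flux ([energy_form_flux]): the wave part is a quadratic form
    whose norm is the fast magnetosonic speed ([fast_wave_bound]), and the remaining
    term, linear in the arbitrary velocity [v], is controlled by the last entry of the
    maximum in [alpha_l] together with the contribution of the jump of the magnetic
    field ([flux_pair_bound]).

    In the scheme, the fluxes on opposite faces of a cell are paired in this way, outer
    traces with inner traces of the opposite face. The defects sum to a multiple of the
    discrete divergence and vanish, and the affine function at the update is
    bounded below by its value at the cell average minus [a1 dt / dx] and [a2 dt / dy]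
    times its mean values at the inner traces on the faces
    ([next_average_gt0]). Finally the cell average is a combination with nonnegative weights
    of point values in two ways, Gauss-Lobatto in one direction and Gauss in the other
    ([cell_average_quadrature]), in which the traces on the two opposite faces have the same
    weight, the first Gauss-Lobatto weight ([cell_average_ge_x], [cell_average_ge_y]); the
    CFL condition is exactly what allows the subtraction. Nonnegativity of the weights
    and equality of the end weights follow from exactness of the rules alone, on
    suitable test polynomials ([gauss_weight_ge0], [gauss_lobatto_weight_ge0],
    [gauss_lobatto_end_weights]). *)

(** * Integrals of tensor products *)

Section ProductIntegral.
Context d1 d2 (T1 : measurableType d1) (T2 : measurableType d2) (R : realType).
Variables (m1 : {sigma_finite_measure set T1 -> \bar R}).
Variables (m2 : {sigma_finite_measure set T2 -> \bar R}).

(** The iterated integral of the absolute value is the product of the two integrals, so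
    Tonelli's criterion applies. *)
Lemma integrable_tensor (f : T1 -> R) (g : T2 -> R) :
  m1.-integrable setT (EFin \o f) -> m2.-integrable setT (EFin \o g) ->
  (m1 \x m2)%E.-integrable setT (fun z => (f z.1 * g z.2)%:E).
Proof.
move=> If Ig.
have mf : measurable_fun setT f by apply/measurable_EFinP; apply: measurable_int If.
have mg : measurable_fun setT g by apply/measurable_EFinP; apply: measurable_int Ig.
apply/integrable12ltyP.
  apply/measurable_EFinP; apply: measurable_funM.
    by apply: measurableT_comp.
  by apply: measurableT_comp.
move/integrableP: If => [_ If]; move/integrableP: Ig => [_ Ig].
rewrite (eq_integral (fun x => (\int[m2]_y `|(g y)%:E|) * `|(f x)%:E|)%E); last first.
  move=> x _ /=.
  rewrite muleC -ge0_integralZl//=; first last.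
    by apply/measurable_EFinP; apply: measurableT_comp.
  by apply: eq_integral => y _; rewrite normrM EFinM.
have g0 : (0 <= \int[m2]_y `|(g y)%:E|)%E by apply: integral_ge0.
rewrite ge0_integralZl//=; last by apply/measurable_EFinP; apply: measurableT_comp.
rewrite lte_mul_pinfty//.
by rewrite ge0_fin_numE.
Qed.

Lemma Rintegral_tensor (A : set T1) (B : set T2) (f : T1 -> R) (g : T2 -> R) :
  measurable A -> measurable B ->
  m1.-integrable A (EFin \o f) -> m2.-integrable B (EFin \o g) ->
  (m1 \x m2)%E.-integrable (A `*` B) (EFin \o (fun z => f z.1 * g z.2)) /\
  \int[(m1 \x m2)%E]_(z in A `*` B) (f z.1 * g z.2) =
  (\int[m1]_(x in A) f x) * (\int[m2]_(y in B) g y).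
Proof.
move=> mA mB If Ig.
have If' : m1.-integrable setT (EFin \o (f \_ A)).
  by rewrite -restrict_EFin; apply/integrable_restrict => //; rewrite setTI.
have Ig' : m2.-integrable setT (EFin \o (g \_ B)).
  by rewrite -restrict_EFin; apply/integrable_restrict => //; rewrite setTI.
have E : (fun z : T1 * T2 => f z.1 * g z.2) \_ (A `*` B) =
    (fun z => (f \_ A) z.1 * (g \_ B) z.2).
  apply/funext => -[x y] /=; rewrite /patch /= in_setX /=.
  by case: (x \in A) => /=; case: (y \in B) => //=; rewrite ?mul0r ?mulr0.
have mAB : measurable (A `*` B) by apply: measurableX.
have I := integrable_tensor If' Ig'; split.
  rewrite -[A `*` B]setTI; apply/(integrable_restrict _ _ _) => //.
  by rewrite restrict_EFin E.
rewrite [LHS]Rintegral_mkcond E [\int[m1]_(x in A) _]Rintegral_mkcond.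
rewrite [\int[m2]_(x in B) _]Rintegral_mkcond /Rintegral -integral12_prod_meas1//.
rewrite /fubini_F /=.
under eq_integral => x _ do under eq_integral => y _ do rewrite EFinM.
under eq_integral => x _.
  rewrite integralZl//. over.
have /fineK <- : (\int[m2]_x ((g \_ B) x)%:E)%E \is a fin_num.
  exact: integrable_fin_num.
rewrite integralZr//= fineM//.
exact: integrable_fin_num.
Qed.
End ProductIntegral.

(** * Averages of polynomials *)

Section Average.
Variable R : realType.
Local Notation mu := (@lebesgue_measure R).
Implicit Types (a b c d : R) (q : {poly R}).

Lemma integrable_poly_cc q a b : mu.-integrable `[a, b] (EFin \o horner q).
Proof.
apply: continuous_compact_integrable; first exact: segment_compact.
by apply: continuous_subspaceT => x; exact: continuous_horner.
Qed.

Lemma integrable_poly_oo q a b : mu.-integrable `]a, b[ (EFin \o horner q).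
Proof.
apply: integrableS (integrable_poly_cc q a b) => //.
exact: subset_itv_oo_cc.
Qed.

Lemma Rintegral_poly_oo q a b :
  \int[mu]_(x in `]a, b[) q.[x] = \int[mu]_(x in `[a, b]) q.[x].
Proof.
rewrite Rintegral_itv_obnd_cbnd; last exact: integrable_poly_oo.
rewrite Rintegral_itv_bndo_bndc//.
apply: integrableS (integrable_poly_cc q a b) => //.
exact: subset_itv_co_cc.
Qed.

Lemma average_ge0 a b q : a < b ->
  (forall x, a <= x <= b -> 0 <= q.[x]) -> 0 <= average a b (horner q).
Proof.
move=> ab q0; apply: mulr_ge0; first by rewrite invr_ge0 subr_ge0 ltW.
by apply: Rintegral_ge0 => x; rewrite /= in_itv /=; exact: q0.
Qed.

Lemma average1 a b : a < b -> average a b (horner 1) = 1.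
Proof.
move=> ab; rewrite /average (@eq_Rintegral _ _ _ _ _ (cst 1)); last first.
  by move=> x _ /=; rewrite hornerC.
rewrite Rintegral_cst//.
have mab : mu `[a, b] = (b - a)%:E by rewrite lebesgue_measure_itv /= lte_fin ab EFinB.
rewrite [X in fine X]mab /= mul1r mulVf//.
by rewrite subr_eq0 gt_eqF.
Qed.

(** Substituting [x := a + b - x] preserves the integral over [[a, b]]. This is what
    makes the two end weights of a Gauss-Lobatto rule equal. *)
Lemma average_reflect a b q : a < b ->
  average a b (horner (q \Po ((a + b)%:P - 'X))) = average a b (horner q).
Proof.
move=> ab; congr (_ * _); rewrite /Rintegral; congr fine.
pose F x : R := a + b - x.
have dF (x : R) : is_derive x (1 : R) F (-1).
  rewrite /F -[X in is_derive _ _ _ X]add0r.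
  by apply: is_deriveD.
have F' : F^`()%classic = cst (-1).
  by apply/funext => x; rewrite derive1E; apply: derive_val.
have Fa : F a = b by rewrite /F addrC addKr.
have Fb : F b = a by rewrite /F addrK.
have cF : continuous F.
  by move=> x; apply: differentiable_continuous; apply/derivable1_diffP; apply: ex_derive.
have := @integration_by_substitution_decreasing R F (horner q) a b (ltW ab).
rewrite Fa Fb => ->.
- apply: eq_integral => x _; rewrite F' /= !fctE opprK mulr1.
  by rewrite horner_comp !hornerE.
- by move=> x y _ _; rewrite /F ltrD2l ltrN2.
- by rewrite F' => x _; exact: cvg_cst.
- by rewrite F'; exact: is_cvg_cst.
- by rewrite F'; exact: is_cvg_cst.
- split.
  + by move=> x _; apply: ex_derive.
  + by apply: cvg_at_right_filter; apply: cF.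
  + by apply: cvg_at_left_filter; apply: cF.
- by apply: continuous_subspaceT => x; exact: continuous_horner.
Qed.

End Average.

(** * Weights of Gauss and Gauss-Lobatto rules *)

Section Rules.
Variable R : realType.
Implicit Types (a b : R) (n : nat).

Definition node_poly n (x : 'I_n -> R) (S : {set 'I_n}) : {poly R} :=
  \prod_(i in S) ('X - (x i)%:P).

Lemma size_node_poly n (x : 'I_n -> R) (S : {set 'I_n}) : size (node_poly x S) = #|S|.+1.
Proof. by rewrite /node_poly -big_enum size_prod_XsubC -cardE. Qed.

Lemma horner_node_poly n (x : 'I_n -> R) (S : {set 'I_n}) t :
  (node_poly x S).[t] = \prod_(i in S) (t - x i).
Proof. by rewrite horner_prod; apply: eq_bigr => i _; rewrite !hornerE. Qed.

Lemma node_poly_eq0 n (x : 'I_n -> R) (S : {set 'I_n}) k : k \in S -> (node_poly x S).[x k] = 0.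
Proof. by move=> kS; rewrite horner_node_poly (bigD1 k)//= subrr mul0r. Qed.

Lemma node_poly_neq0 n (x : 'I_n -> R) (S : {set 'I_n}) t :
  (forall i, i \in S -> t != x i) -> (node_poly x S).[t] != 0.
Proof.
by move=> tS; rewrite horner_node_poly; apply/prodf_neq0 => i /tS; rewrite subr_eq0.
Qed.

Lemma increasing_inj n (x : 'I_n -> R) :
  (forall k l : 'I_n, (k < l)%N -> x k < x l) -> injective x.
Proof.
move=> x_incr k l; apply: contra_eq; rewrite neq_ltn => /orP[] /x_incr.
  by move/lt_eqF/negbT.
by move/gt_eqF/negbT.
Qed.

(** A rule evaluated on a nonnegative polynomial that vanishes at every node but one
    returns a positive multiple of the weight of that node. The next lemmas only have
    to exhibit such a polynomial within the degree of exactness. *)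
Lemma weight_ge0 n a b (x w : 'I_n -> R) (q : {poly R}) k : a < b ->
  average a b (horner q) = \sum_(i < n) w i * q.[x i] ->
  (forall t, a <= t <= b -> 0 <= q.[t]) ->
  0 < q.[x k] -> (forall i, i != k -> q.[x i] = 0) -> 0 <= w k.
Proof.
move=> ab Eq q0 qk qi; have := average_ge0 ab q0.
rewrite Eq (bigD1 k)//= big1 ?addr0 ?pmulr_lge0// => i ik.
by rewrite qi// mulr0.
Qed.

Lemma gauss_weight_ge0 n a b (x w : 'I_n -> R) k :
  a < b -> gauss_rule a b x w -> 0 <= w k.
Proof.
move=> ab [/increasing_inj x_inj _ exact_rule].
pose q := node_poly x [set~ k] ^+ 2.
have n0 : (0 < n)%N by case: n k {x w x_inj exact_rule q} => // -[].
have sq : (size q <= 2 * n)%N.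
  apply: leq_trans (size_poly_exp_leq _ _) _.
  rewrite size_node_poly cardsC1 card_ord /=; lia.
apply: (weight_ge0 (q := q) ab (exact_rule _ sq)).
- by move=> t _; rewrite horner_exp sqr_ge0.
- rewrite horner_exp exprn_even_gt0//=; apply: node_poly_neq0 => i.
  by rewrite !inE => ik; rewrite (inj_eq x_inj) eq_sym.
- by move=> i ik; rewrite horner_exp node_poly_eq0 ?expr0n// !inE.
Qed.

Lemma gauss_weight_sum n a b (x w : 'I_n -> R) : (0 < n)%N ->
  a < b -> gauss_rule a b x w -> \sum_(k < n) w k = 1.
Proof.
move=> n0 ab [_ _ exact_rule]; rewrite -(average1 ab) exact_rule.
  by apply: eq_bigr => k _; rewrite hornerC mulr1.
by rewrite size_poly1; lia.
Qed.

Lemma size_CsubX (c : R) : size (c%:P - 'X) = 2%N.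
Proof. by rewrite -opprB size_polyN size_XsubC. Qed.

Let evalE := (horner_exp, hornerM, hornerD, hornerN, hornerC, hornerX).

Section Lobatto.
Variables (n : nat) (a b : R) (x w : 'I_n -> R).
Hypotheses (ab : a < b) (rule : gauss_lobatto_rule a b x w).

Let x_inj : injective x. Proof. by case: rule => /increasing_inj. Qed.

Lemma gauss_lobatto_ends : exists i0 i1 : 'I_n, [/\ x i0 = a, x i1 = b & i0 != i1].
Proof.
have [_ _ [[i0 xi0] [i1 xi1]] _] := rule; exists i0, i1; split => //.
by apply: contraTN ab => /eqP i01; rewrite -xi0 -xi1 i01 ltxx.
Qed.

Lemma gauss_lobatto_first (k : 'I_n) : k = 0%N :> nat -> x k = a.
Proof.
have [x_incr x_itv [[i0 xi0] _] _] := rule => k0.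
case: (posnP i0) => [i00|i0_gt0].
  by rewrite -xi0; congr x; apply: val_inj; rewrite /= k0.
have := x_incr k i0; rewrite k0 => /(_ i0_gt0); rewrite xi0 ltNge.
by have /andP[-> _] := x_itv k.
Qed.

Section Ends.
Variables i0 i1 : 'I_n.
Hypotheses (xi0 : x i0 = a) (xi1 : x i1 = b).

Let i01 : i0 != i1.
Proof. by apply: contraTN ab => /eqP i01; rewrite -xi0 -xi1 i01 ltxx. Qed.

Let card_interior : #|[set~ i0] :\ i1| = (n - 2)%N.
Proof.
have := cardsD1 i1 [set~ i0]; rewrite cardsC1 card_ord !inE eq_sym i01 /=.
lia.
Qed.

Let n_ge2 : (2 <= n)%N.
Proof.
rewrite -[leqRHS]card_ord (leq_trans _ (max_card [set i0; i1]%SET))//.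
by rewrite cards2 i01.
Qed.

(** At an end node only the other end has to be killed by a linear factor; the degree
    is then exactly 2n-3. *)
Lemma gauss_lobatto_left_weight_ge0 : 0 <= w i0.
Proof.
have [_ x_itv _ exact_rule] := rule.
pose q := (b%:P - 'X) * node_poly x ([set~ i0] :\ i1) ^+ 2.
have sq : (size q <= 2 * n - 2)%N.
  apply: leq_trans (size_polyMleq _ _) _; rewrite -subn1 leq_subLR.
  apply: leq_trans (leq_add (leqnn _) (size_poly_exp_leq _ _)) _.
  rewrite size_node_poly card_interior size_CsubX /=; lia.
apply: (weight_ge0 (q := q) ab (exact_rule _ sq)).
- by move=> t /andP[_ tb]; rewrite !evalE mulr_ge0 ?subr_ge0// sqr_ge0.
- rewrite !evalE xi0 mulr_gt0 ?subr_gt0// exprn_even_gt0//=.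
  by apply: node_poly_neq0 => i; rewrite !inE => /andP[_ ii0]; rewrite -xi0 (inj_eq x_inj) eq_sym.
- move=> i ii0; have [->|ii1] := eqVneq i i1; first by rewrite !evalE xi1 subrr mul0r.
  by rewrite !evalE node_poly_eq0 ?expr0n ?mulr0// !inE ii0 ii1.
Qed.

(** The square of the product over the remaining interior nodes has degree 2n-6; the
    factor [(X - a) * (b - X)] kills both ends, keeps the sign on [[a, b]], and brings
    the degree to 2n-4, within the exactness 2n-3. *)
Lemma gauss_lobatto_interior_weight_ge0 k : k != i0 -> k != i1 -> 0 <= w k.
Proof.
move=> ki0 ki1; have [_ x_itv _ exact_rule] := rule.
pose S := [set~ i0] :\ i1 :\ k.
pose q := ('X - a%:P) * (b%:P - 'X) * node_poly x S ^+ 2.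
have cS : (#|S|.+1 = n - 2)%N.
  by have := cardsD1 k ([set~ i0] :\ i1); rewrite card_interior !inE ki0 ki1.
have sq : (size q <= 2 * n - 2)%N.
  apply: leq_trans (size_polyMleq _ _) _; rewrite -subn1 leq_subLR.
  apply: leq_trans (leq_add (size_polyMleq _ _) (size_poly_exp_leq _ _)) _.
  have sXa : size ('X - a%:P) = 2%N by exact: size_XsubC.
  rewrite size_node_poly size_CsubX sXa /=; move: cS; set c := #|S|; clearbody c; clear; lia.
have ends i : i \notin S -> i != k -> i = i0 \/ i = i1.
  move=> + ik; rewrite !inE ik /= negb_and !negbK.
  by case/orP => /eqP ->; [right|left].
apply: (weight_ge0 (q := q) ab (exact_rule _ sq)).
- move=> t /andP[ta tb]; rewrite !evalE; apply: mulr_ge0; last exact: sqr_ge0.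
  by rewrite mulr_ge0 ?subr_ge0.
- have /andP[xka xkb] := x_itv k.
  rewrite !evalE mulr_gt0//.
    rewrite mulr_gt0// subr_gt0 lt_neqAle ?xka ?xkb ?andbT.
      by rewrite -xi0 (inj_eq x_inj) eq_sym.
    by rewrite -xi1 (inj_eq x_inj).
  rewrite exprn_even_gt0//=; apply: node_poly_neq0 => i.
  by rewrite !inE => /andP[ik _]; rewrite (inj_eq x_inj) eq_sym.
- move=> i ik; have [iS|iS] := boolP (i \in S).
    by rewrite !evalE node_poly_eq0 ?expr0n ?mulr0.
  by case: (ends i iS ik) => ->; rewrite !evalE ?xi0 ?xi1 subrr ?mul0r ?mulr0 ?mul0r.
Qed.

(** The nodes are not known beforehand to be symmetric about the midpoint. The test
    polynomial is therefore made to vanish at the interior nodes and at their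
    reflections, and at [b]: the rule reads off [w i0] from it and [w i1] from its
    reflection, while both have the same average. Its degree is exactly 2n-3. *)
Lemma gauss_lobatto_end_weights : w i0 = w i1.
Proof.
have [_ x_itv _ exact_rule] := rule.
pose S := [set~ i0] :\ i1.
pose y i := a + b - x i.
pose q := (b%:P - 'X) * node_poly x S * node_poly y S.
pose r := (a + b)%:P - 'X : {poly R}.
have sr : size r = 2%N by exact: size_CsubX.
have sq : (size q <= 2 * n - 2)%N.
  apply: leq_trans (size_polyMleq _ _) _; rewrite -subn1 leq_subLR.
  apply: leq_trans (leq_add (size_polyMleq _ _) (leqnn _)) _.
  rewrite !size_node_poly card_interior size_CsubX /=; lia.
have qa : q.[a] != 0.
  rewrite !evalE !mulf_neq0//; first by rewrite subr_eq0 gt_eqF.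
    apply: node_poly_neq0 => i; rewrite !inE => /andP[_ ii0].
    by rewrite -xi0 (inj_eq x_inj) eq_sym.
  apply: node_poly_neq0 => i; rewrite !inE => /andP[ii1 _].
  rewrite /y -subr_eq0; have -> : a - (a + b - x i) = x i - b by ring.
  by rewrite subr_eq0 -xi1 (inj_eq x_inj).
have interior i : i != i0 -> i != i1 -> i \in S by rewrite !inE => -> ->.
have := average_reflect q ab.
rewrite exact_rule ?size_comp_poly2// exact_rule//.
rewrite (bigD1 i1)//= big1 ?addr0 => [|i ii1]; last first.
  rewrite horner_comp !evalE; have [->|ii0] := eqVneq i i0.
    by rewrite xi0 addrAC subrr add0r subrr !mul0r mulr0.
  by rewrite -/(y i) (node_poly_eq0 y) ?mulr0// interior.
rewrite (bigD1 i0)//= big1 ?addr0 => [|i ii0]; last first.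
  rewrite !evalE; have [->|ii1] := eqVneq i i1; first by rewrite xi1 subrr !mul0r mulr0.
  by rewrite node_poly_eq0 ?mulr0 ?mul0r ?mulr0// interior.
have -> : (q \Po r).[x i1] = q.[a] by rewrite horner_comp /r !evalE xi1 addrK.
by rewrite xi0 => /(mulIf qa).
Qed.
End Ends.

Lemma gauss_lobatto_weight_ge0 k : 0 <= w k.
Proof.
have [i0 [i1 [xi0 xi1 i01]]] := gauss_lobatto_ends.
have [->|ki0] := eqVneq k i0; first exact: gauss_lobatto_left_weight_ge0 xi0 xi1.
have [->|ki1] := eqVneq k i1; last exact: gauss_lobatto_interior_weight_ge0 xi0 xi1 _ _ _.
by rewrite -(gauss_lobatto_end_weights xi0 xi1); exact: gauss_lobatto_left_weight_ge0 xi0 xi1.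
Qed.

Lemma gauss_lobatto_weight_sum : \sum_(k < n) w k = 1.
Proof.
have [i0 [i1 [_ _ i01]]] := gauss_lobatto_ends.
have n2 : (2 <= n)%N.
  rewrite -[leqRHS]card_ord (leq_trans _ (max_card [set i0; i1]%SET))//.
  by rewrite cards2 i01.
have [_ _ _ exact_rule] := rule.
rewrite -(average1 ab) exact_rule; last by rewrite size_poly1; lia.
by apply: eq_bigr => k _; rewrite hornerC mulr1.
Qed.

End Lobatto.
End Rules.

(** * Cell averages by tensor quadrature *)

Section CellAverage.
Variable R : realType.
Local Notation mu := (@lebesgue_measure R).

Lemma horner2E (q : {poly {poly R}}) K (x y : R) : (size q <= K.+1)%N ->
  q.[x, y] = \sum_(i < K.+1) 'X^i.[x] * (q`_i).[y].
Proof.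
move=> sq; rewrite (horner_coef_wide _ sq) horner_sum.
by apply: eq_bigr => i _; rewrite hornerM -rmorphXn /= hornerC hornerXn mulrC.
Qed.

Lemma Rintegral_bivariate (I : eqType) (s : seq I) (f g : I -> {poly R}) (a b c d : R) :
  (mu \x mu)%E.-integrable (`]a, b[ `*` `]c, d[)
    (EFin \o (fun z => \sum_(i <- s) (f i).[z.1] * (g i).[z.2])) /\
  \int[(mu \x mu)%E]_(z in `]a, b[ `*` `]c, d[)
    (\sum_(i <- s) (f i).[z.1] * (g i).[z.2]) =
  \sum_(i <- s) (\int[mu]_(x in `[a, b]) (f i).[x]) * (\int[mu]_(y in `[c, d]) (g i).[y]).
Proof.
have mD : measurable
    (`]a, b[%classic `*` `]c, d[%classic : set (measurableTypeR R * measurableTypeR R)).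
  by apply: measurableX.
elim: s => [|i s [IHi IHs]].
  have E0 : (fun z : R * R => \sum_(i <- [::]) (f i).[z.1] * (g i).[z.2]) = cst 0.
    by apply/funext => z; rewrite big_nil.
  rewrite big_nil E0; split; first exact: integrable0.
  by rewrite Rintegral_cst// mul0r.
have [Ii Es] := @Rintegral_tensor _ _ _ _ R mu mu _ _ _ _ (measurable_itv _) (measurable_itv _)
  (integrable_poly_oo (f i) a b) (integrable_poly_oo (g i) c d).
rewrite big_cons -[in RHS]Rintegral_poly_oo -[X in _ * X + _]Rintegral_poly_oo -Es -IHs.
rewrite -RintegralD//; split.
  have -> : (EFin \o (fun z : R * R => \sum_(j <- (i :: s)) (f j).[z.1] * (g j).[z.2])) =
    ((EFin \o (fun z => ((f i).[z.1] * (g i).[z.2])%R)) \+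
    (EFin \o (fun z => (\sum_(j <- s) (f j).[z.1] * (g j).[z.2])%R)))%E.
    by apply/funext => z /=; rewrite big_cons.
  exact: integrableD.
by apply: eq_Rintegral => z _; rewrite big_cons.
Qed.

(** A polynomial of total degree at most K is a sum of products [x^i q_i(y)] whose
    factors both have degree at most K, and by Fubini the average of such a product
    is the product of the averages. *)
Lemma cell_average_quadrature K n m (a b c d : R) (x w : 'I_n -> R) (y w' : 'I_m -> R)
    (P : poly_state R) :
  (forall q : {poly R}, (size q <= K.+1)%N ->
     average a b (horner q) = \sum_(k < n) w k * q.[x k]) ->
  (forall q : {poly R}, (size q <= K.+1)%N ->
     average c d (horner q) = \sum_(l < m) w' l * q.[y l]) ->
  (forall k, degree_le K (P 0 k)) ->
  cell_average P a b c d =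
    \sum_(k < n) \sum_(l < m) (w k * w' l) *: eval_state P (x k) (y l).
Proof.
move=> exact_x exact_y degP; apply/matrixP => o j.
rewrite summxE; under eq_bigr => k _.
  rewrite summxE; under eq_bigr => l _ do rewrite !mxE.
  over.
rewrite !mxE ord1; move: (P 0 j) (degP j) => q degq.
have sq : (size q <= K.+1)%N.
  apply/leq_sizeP => i Ki; apply/polyP => l; rewrite coef0 degq//.
  exact: leq_trans (leq_addr _ _).
have sqi i : (size (q`_i)%R <= K.+1)%N.
  by apply/leq_sizeP => l Kl; rewrite degq//; exact: leq_trans (leq_addl _ _).
under [in LHS]eq_Rintegral do rewrite (horner2E _ _ sq).
have [_ ->] := Rintegral_bivariate (index_enum 'I_K.+1)
  (fun i : 'I_K.+1 => 'X^i) (fun i : 'I_K.+1 => q`_i) a b c d.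
rewrite invfM mulr_sumr.
under [LHS]eq_bigr => i _.
  rewrite mulrACA -!/(average _ _ _) exact_x ?size_polyXn//.
  rewrite exact_y// mulr_suml.
  under eq_bigr => k _ do rewrite mulr_sumr.
  over.
rewrite exchange_big/=; apply: eq_bigr => k _.
rewrite exchange_big/=; apply: eq_bigr => l _.
rewrite (horner2E _ _ sq) mulr_sumr; apply: eq_bigr => i _.
by rewrite mulrACA.
Qed.
End CellAverage.

(** * The Euclidean structure of 3-space *)

Section DotProduct.
Variable R : realType.
Implicit Types (u v w : 'rV[R]_3) (a : R).

Lemma dotC u v : dot u v = dot v u.
Proof. by apply: eq_bigr => k _; rewrite mulrC. Qed.

Lemma dotDl u v w : dot (u + v) w = dot u w + dot v w.
Proof. by rewrite -big_split; apply: eq_bigr => k _; rewrite mxE mulrDl. Qed.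

Lemma dotZl a u v : dot (a *: u) v = a * dot u v.
Proof. by rewrite /dot mulr_sumr; apply: eq_bigr => k _; rewrite mxE mulrA. Qed.

Lemma dotNl u v : dot (- u) v = - dot u v.
Proof. by rewrite -scaleN1r dotZl mulN1r. Qed.

Lemma dotDr u v w : dot w (u + v) = dot w u + dot w v.
Proof. by rewrite dotC dotDl !(dotC w). Qed.

Lemma dotZr a u v : dot u (a *: v) = a * dot u v.
Proof. by rewrite dotC dotZl dotC. Qed.

Lemma dotNr u v : dot u (- v) = - dot u v.
Proof. by rewrite dotC dotNl dotC. Qed.

Definition dotE := (dotDl, dotDr, dotNl, dotNr, dotZl, dotZr).

Lemma dot_delta u l : dot u (delta_mx 0 l) = u 0 l.
Proof.
rewrite /dot (bigD1 l)//= big1 ?addr0 => [|k kl]; first by rewrite mxE !eqxx mulr1.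
by rewrite mxE eqxx (negbTE kl) mulr0.
Qed.

Lemma dot_ge0 u : 0 <= dot u u.
Proof. by apply: sumr_ge0 => k _; rewrite -expr2 sqr_ge0. Qed.

Lemma sqr_coord_le_dot u l : u 0 l ^+ 2 <= dot u u.
Proof.
by rewrite /dot (bigD1 l)//= -expr2 lerDl sumr_ge0// => k _; rewrite -expr2 sqr_ge0.
Qed.

Lemma enorm_sqr u : enorm u ^+ 2 = dot u u.
Proof. by rewrite sqr_sqrtr// dot_ge0. Qed.

Lemma cauchy_schwarz u v : dot u v ^+ 2 <= dot u u * dot v v.
Proof.
have := dot_ge0 (dot u u *: v - dot u v *: u).
rewrite !dotE (dotC v u).
set a := dot u u; set b := dot v v; set c := dot u v => H.
have a0 : 0 <= a by apply: dot_ge0.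
have [a00|a_neq0] := eqVneq a 0; last first.
  have a_gt0 : 0 < a by rewrite lt_def a_neq0.
  rewrite -subr_ge0 -(pmulr_rge0 _ a_gt0).
  by apply: le_trans H _; rewrite le_eqVlt; apply/orP; left; apply/eqP; ring.
have u0 : u = 0.
  apply/rowP => k; rewrite mxE; apply/eqP; rewrite -sqrf_eq0.
  by have := sqr_coord_le_dot u k; rewrite -/a a00 => H'; rewrite eq_le H' sqr_ge0.
have c0 : c = 0 by rewrite /c u0 -(scale0r v) dotZl mul0r.
by rewrite c0 expr0n mulr_ge0 ?dot_ge0.
Qed.

Lemma cauchy_schwarz_orth u v l :
  (dot u v - u 0 l * v 0 l) ^+ 2 <=
  (dot u u - u 0 l ^+ 2) * (dot v v - v 0 l ^+ 2).
Proof.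
have := cauchy_schwarz (u - u 0 l *: delta_mx 0 l) (v - v 0 l *: delta_mx 0 l).
rewrite !dotE !(dotC (delta_mx 0 l) _) !dot_delta !mxE !eqxx !mulr1.
set a := dot u v; set b := dot u u; set c := dot v v => H.
by apply: le_trans (le_trans _ H) _; rewrite le_eqVlt; apply/orP; left; apply/eqP; ring.
Qed.

End DotProduct.

(** * Scalar inequalities *)

Section RealInequalities.
Variable R : realType.
Implicit Types x y z : R.

(** The inequality of arithmetic and geometric means, in the form in which it bounds a
    cross term by the two diagonal terms of a quadratic form. *)
Lemma norm_le_addr x y z : 0 <= x -> 0 <= y -> z ^+ 2 <= 4 * x * y -> `|z| <= x + y.
Proof.
move=> x0 y0 zxy; rewrite -ler_sqr ?nnegrE ?addr_ge0// real_normK ?num_real//.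
have := sqr_ge0 (x - y); nra.
Qed.

(** The Cauchy-Schwarz inequality in the plane, with weights [r] and [s]. *)
Lemma sqr_weighted_sum_le (r s x y a b : R) : 0 < r -> 0 < s ->
  (a * x + b * y) ^+ 2 <= (a ^+ 2 / r + b ^+ 2 / s) * (r * x ^+ 2 + s * y ^+ 2).
Proof.
move=> r0 s0; rewrite -subr_ge0.
have -> : (a ^+ 2 / r + b ^+ 2 / s) * (r * x ^+ 2 + s * y ^+ 2) - (a * x + b * y) ^+ 2
   = (a * s * y - b * r * x) ^+ 2 / (r * s).
  by field; rewrite !gt_eqF.
by rewrite mulr_ge0 ?sqr_ge0// invr_ge0 mulr_ge0 ?ltW.
Qed.

(** With [k] the square of the sound-like speed, [h] that of the Alfven speed and [g]
    that of its normal component, [t] is the larger root of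
    [t^2 - (k + h) t + k g], the squared fast speed. The last identity rewrites this
    equation; the two inequalities hold because the discriminant is at least
    [(k + h - 2 g)^2]. Together they say that the matrix with diagonal
    [t - (k + h - g)], [t - g] and off-diagonal entry of square [g (h - g)] is positive
    semidefinite. *)
Lemma fast_wave_root (k h g : R) : 0 <= k -> 0 <= g <= h ->
  let t := (k + h + Num.sqrt ((k + h) ^+ 2 - 4 * (k * g))) / 2 in
  [/\ g <= t, k + h - g <= t & (t - g) * (t - (k + h - g)) = g * (h - g)].
Proof.
move=> k0 /andP[g0 gh] t.
have D0 : (k + h - 2 * g) ^+ 2 <= (k + h) ^+ 2 - 4 * (k * g) by nra.
have := le_trans (sqr_ge0 _) D0 => /sqr_sqrtr.
have := sqrtr_ge0 ((k + h) ^+ 2 - 4 * (k * g)).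
rewrite /t; set d := Num.sqrt _ => d0 dE.
have : `|k + h - 2 * g| <= d.
  by rewrite -ler_sqr ?nnegrE// real_normK ?num_real// dE.
rewrite ler_norml => /andP[d1 d2]; split; [lra|lra|].
apply/eqP; rewrite -subr_eq0; apply/eqP.
transitivity ((d ^+ 2 - ((k + h) ^+ 2 - 4 * (k * g))) / 4); first by field.
by rewrite dE subrr mul0r.
Qed.
End RealInequalities.

(** * The fast magnetosonic speed *)

Ltac nonneg := repeat first
  [exact: sqr_ge0 | exact: dot_ge0 | by [] | exact: ltW | apply: mulr_ge0 | apply: addr_ge0].

Section WaveSpeed.
Variables (R : realType) (p : R -> R -> R) (l : 'I_3).
Implicit Types (U W : state R) (u b v B : 'rV[R]_3).

Lemma c_speed_ge0 U : 0 <= c_speed p l U.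
Proof. by rewrite mulr_ge0// ?invr_ge0 sqrtr_ge0. Qed.

Lemma internal_energyE U : internal_energy U =
  energy U - (dot (momentum U) (momentum U) / density U + dot (magnetic U) (magnetic U)) / 2.
Proof. by rewrite /internal_energy !enorm_sqr. Qed.

(** Multiplying [fast_wave_root] by the density avoids the normalized field
    [B / sqrt rho] in the estimates that follow. *)
Lemma c_speed_sqr_spec U : 0 < density U ->
  let r := density U in let B := magnetic U in
  let t := r * c_speed p l U ^+ 2 in let k := r * cs_speed p U ^+ 2 in
  let g := B 0 l ^+ 2 in let h := dot B B in
  [/\ g <= t, k + h - g <= t & (t - g) * (t - (k + h - g)) = g * (h - g)].
Proof.
move=> r_gt0 r B t k g h.
have g0 : 0 <= g / r by rewrite divr_ge0 ?sqr_ge0 ?ltW.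
have gh : g / r <= h / r by rewrite ler_pM2r ?invr_gt0// sqr_coord_le_dot.
have := fast_wave_root (sqr_ge0 (cs_speed p U)); move/(_ (h / r) (g / r)).
rewrite g0 gh => /(_ isT) [].
rewrite !mulrA; set T := _ / 2 => gT hT prodT.
have cE : c_speed p l U ^+ 2 = T.
  rewrite /c_speed enorm_sqr exprMn exprVn sqr_sqrtr// sqr_sqrtr.
    by rewrite mulrC /T !mulrA.
  by rewrite addr_ge0 ?sqrtr_ge0// addr_ge0 ?sqr_ge0// (le_trans g0).
have rT x : x / r <= T -> x <= t by rewrite ler_pdivrMr// mulrC /t cE.
have gk : k + h - g = r * (cs_speed p U ^+ 2 + h / r - g / r).
  by rewrite /k; field; rewrite gt_eqF.
split; first exact: rT.
  by rewrite gk /t cE ler_pM2l.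
have -> : g * (h - g) = r ^+ 2 * (g / r * (h / r - g / r)).
  by field; rewrite gt_eqF.
rewrite -prodT gk /t cE; field; rewrite gt_eqF//.
Qed.

(** The left-hand side is bilinear in the thermal and magnetic amplitudes on one side
    and the velocity on the other: writing [m = u_l B - B_l u], it equals
    [p u_l + m . b]. By the Cauchy-Schwarz inequality its square is at most
    [(2 eps + |b|^2) (k u_l^2 + |m|^2)], where [k = p^2 / (2 eps)], and the second factor
    is a quadratic form in [u] whose largest eigenvalue is the density times the square
    of the fast speed. Splitting [u] into its [l]-th component and the orthogonal rest
    turns this last fact into the semidefiniteness obtained from [fast_wave_root]. *)
Lemma fast_wave_bound U u b : admissible U ->
  `|pressure p U * u 0 l + u 0 l * dot (magnetic U) b - magnetic U 0 l * dot u b| <=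
  c_speed p l U * (internal_energy U + density U * dot u u / 2 + dot b b / 2).
Proof.
move=> [r_gt0 eps_gt0]; set B := magnetic U.
have [] := c_speed_sqr_spec r_gt0; rewrite /= -/B.
set r := density U in r_gt0 *; set eps := internal_energy U in eps_gt0 *.
set t := r * _; set k := r * cs_speed p U ^+ 2; set g := B 0 l ^+ 2; set h := dot B B.
move=> gt ht prodt.
have kE : pressure p U ^+ 2 / (2 * eps) = k.
  rewrite /k /cs_speed expr_div_n exprMn sqr_sqrtr; last first.
    by rewrite mulr_ge0// /specific_internal_energy divr_ge0 ?ltW.
  by rewrite /specific_internal_energy -/r -/eps; field; rewrite !gt_eqF.
set c := dot u B - u 0 l * B 0 l.
have c2 : c ^+ 2 <= (dot u u - u 0 l ^+ 2) * (h - g) by exact: cauchy_schwarz_orth.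
have ul : u 0 l ^+ 2 <= dot u u by exact: sqr_coord_le_dot.
have uperp : 0 <= dot u u - u 0 l ^+ 2 by rewrite subr_ge0.
have m2 : dot (u 0 l *: B - B 0 l *: u) (u 0 l *: B - B 0 l *: u) =
    u 0 l ^+ 2 * (h - g) - 2 * (u 0 l * B 0 l) * c + g * (dot u u - u 0 l ^+ 2).
  by rewrite !dotE (dotC B u) /c /g /h; ring.
set m := u 0 l *: B - B 0 l *: u in m2.
(* [t] is the largest eigenvalue of the left-hand side, a quadratic form in [u]. *)
have bound_dir : k * u 0 l ^+ 2 + dot m m <= t * dot u u.
  have : `|2 * (u 0 l * B 0 l) * c| <=
      (t - (k + h - g)) * u 0 l ^+ 2 + (t - g) * (dot u u - u 0 l ^+ 2).
    apply: norm_le_addr; [rewrite -subr_ge0 in ht; nonneg|rewrite -subr_ge0 in gt; nonneg|].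
    have -> : 4 * ((t - (k + h - g)) * u 0 l ^+ 2) * ((t - g) * (dot u u - u 0 l ^+ 2)) =
       4 * u 0 l ^+ 2 * (dot u u - u 0 l ^+ 2) * ((t - g) * (t - (k + h - g))) by ring.
    rewrite prodt.
    have -> : (2 * (u 0 l * B 0 l) * c) ^+ 2 = (4 * u 0 l ^+ 2 * g) * c ^+ 2.
      by rewrite /g; ring.
    have -> : 4 * u 0 l ^+ 2 * (dot u u - u 0 l ^+ 2) * (g * (h - g)) =
      (4 * u 0 l ^+ 2 * g) * ((dot u u - u 0 l ^+ 2) * (h - g)) by ring.
    by apply: ler_wpM2l => //; nonneg.
  rewrite ler_norml m2 => /andP[cl _].
  lra.
set A := (X in `|X|).
have AE : A = pressure p U * u 0 l + dot m b.
  by rewrite /m /A !dotE; ring.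
have A2 : A ^+ 2 <= (2 * eps + dot b b) * (k * u 0 l ^+ 2 + dot m m).
  have := cauchy_schwarz m b => mb.
  have e2 : 0 < 2 * eps by rewrite mulr_gt0.
  have : `|2 * (pressure p U * u 0 l) * dot m b| <=
      k * u 0 l ^+ 2 * dot b b + 2 * eps * dot m m.
    have k0 : 0 <= k by rewrite -kE divr_ge0 ?sqr_ge0 ?ltW.
    apply: norm_le_addr; [nonneg|nonneg|].
    have -> : (2 * (pressure p U * u 0 l) * dot m b) ^+ 2 =
       (4 * (k * (2 * eps)) * u 0 l ^+ 2) * dot m b ^+ 2.
      by rewrite -kE; field; rewrite gt_eqF.
    have -> : 4 * (k * u 0 l ^+ 2 * dot b b) * (2 * eps * dot m m) =
       (4 * (k * (2 * eps)) * u 0 l ^+ 2) * (dot m m * dot b b) by ring.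
    by apply: ler_wpM2l => //; nonneg.
  rewrite ler_norml AE => /andP[_ cr].
  have pk : pressure p U ^+ 2 = k * (2 * eps) by rewrite -kE; field; rewrite gt_eqF.
  have -> : (pressure p U * u 0 l + dot m b) ^+ 2 =
    pressure p U ^+ 2 * u 0 l ^+ 2 + 2 * (pressure p U * u 0 l) * dot m b + dot m b ^+ 2 by ring.
  rewrite pk; lra.
have C0 := c_speed_ge0 U.
set C := c_speed p l U in C0 *.
have dbl : `|2 * A| <= C * (r * dot u u) + C * (2 * eps + dot b b).
  have b0 : 0 <= 2 * eps + dot b b by rewrite addr_ge0 ?dot_ge0 ?mulr_ge0 ?ltW.
  apply: norm_le_addr; [nonneg|nonneg|].
  have -> : 4 * (C * (r * dot u u)) * (C * (2 * eps + dot b b)) =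
    4 * ((2 * eps + dot b b) * (t * dot u u)) by rewrite /t /C; ring.
  rewrite exprMn -natrX ler_pM2l//; apply: le_trans A2 _.
  by apply: ler_wpM2l.
move: dbl; rewrite normrM ger0_norm//; lra.
Qed.

End WaveSpeed.

(** * Generalized Lax-Friedrichs splitting *)

Section FluxPairing.
Variables (R : realType) (p : R -> R -> R) (l : 'I_3).
Implicit Types (U W : state R) (u b v B : 'rV[R]_3).

Lemma density_mk (r : R) m B E : density (mk_state r m B E) = r.
Proof. by rewrite /density row_mxKl mxE. Qed.

Lemma momentum_mk (r : R) m B E : momentum (mk_state r m B E) = m.
Proof. by rewrite /momentum row_mxKr row_mxKl. Qed.

Lemma magnetic_mk (r : R) m B E : magnetic (mk_state r m B E) = B.
Proof. by rewrite /magnetic !row_mxKr row_mxKl. Qed.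

Lemma energy_mk (r : R) m B E : energy (mk_state r m B E) = E.
Proof. by rewrite /energy !row_mxKr mxE. Qed.

Fact density_is_linear : linear_for *%R (@density R).
Proof. by move=> a U W; rewrite /density !linearP !mxE. Qed.

HB.instance Definition _ :=
  GRing.isLinear.Build R (state R) R *%R (@density R) density_is_linear.

(** The pairing of the state with [(|v|^2/2, -v, -B, 1)]. Adding [|B|^2/2] gives a quantity
    affine in the state which dominates the internal energy, with equality when [v] and
    [B] are the velocity and magnetic field of the state ([energy_form_shift]); it
    replaces the nonlinear constraint by a family of affine ones. *)
Definition energy_form v B U : R :=
  density U * (dot v v / 2) - dot v (momentum U) - dot B (magnetic U) + energy U.

Fact energy_form_is_linear v B : linear_for *%R (energy_form v B).
Proof.
move=> a U W; rewrite /energy_form.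
have -> : momentum (a *: U + W) = a *: momentum U + momentum W by rewrite /momentum !linearP.
have -> : magnetic (a *: U + W) = a *: magnetic U + magnetic W by rewrite /magnetic !linearP.
have -> : energy (a *: U + W) = a * energy U + energy W by rewrite /energy !linearP !mxE.
by rewrite (density_is_linear a U W) !dotE; ring.
Qed.

HB.instance Definition _ v B :=
  GRing.isLinear.Build R (state R) R *%R (energy_form v B) (energy_form_is_linear v B).

Lemma energy_form_shift v B U : 0 < density U ->
  energy_form v B U + dot B B / 2 =
    internal_energy U + density U * dot (velocity U - v) (velocity U - v) / 2
    + dot (magnetic U - B) (magnetic U - B) / 2.
Proof.
move=> r_gt0; rewrite /energy_form internal_energyE /velocity !dotE.
rewrite (dotC (momentum U) v) (dotC (magnetic U) B).
by field; rewrite gt_eqF.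
Qed.

(** The identity that organizes the flux estimate: transport of the kinetic and internal
    part by the fluid velocity, a wave part bounded by [fast_wave_bound], and a magnetic
    part that carries the reference velocity [v]. The term in [dot B B] cancels in
    the difference of two fluxes. *)
Lemma energy_form_flux v B U : 0 < density U ->
  let u := velocity U - v in let b := magnetic U - B in
  energy_form v B (flux p l U) - magnetic U 0 l * dot v B =
    velocity U 0 l * (internal_energy U + density U * dot u u / 2)
    + (pressure p U * u 0 l + u 0 l * dot (magnetic U) b - magnetic U 0 l * dot u b)
    + v 0 l * (dot b b - dot B B) / 2.
Proof.
move=> r_gt0 /=; rewrite /energy_form /flux density_mk momentum_mk magnetic_mk energy_mk.
rewrite /total_pressure enorm_sqr internal_energyE.
have -> : momentum U = density U *: velocity U.
  by rewrite /velocity scalerA mulfV ?scale1r// gt_eqF.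
set V := velocity U; set M := magnetic U.
clearbody V M; rewrite !dotE !dot_delta !mxE (dotC V v) (dotC M B) (dotC B V) ?(dotC M V) ?(dotC M v).
by field; rewrite gt_eqF.
Qed.

(** After [energy_form_flux] and [fast_wave_bound], what remains is
    [v_l (|b|^2 - |b'|^2) / 2], where [v] is arbitrary. Writing [v_l] as the [sigma]-average [q]
    of the two fluid velocities minus the [sigma]-average [rho] of the velocity deviations,
    [q] is absorbed by the third entry of the maximum in [alpha_sigma], and [rho] by the
    term with the jump of the magnetic field, because
    [| |b|^2 - |b'|^2 | <= |b' - b| |b' + b|] and [b' - b] is that jump. *)
Lemma flux_pair_bound U W v B sigma : admissible U -> admissible W ->
  energy_form v B (flux p l U) - energy_form v B (flux p l W)
    - dot v B * (magnetic U 0 l - magnetic W 0 l) <=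
  alpha_sigma p l U W sigma *
    ((energy_form v B U + dot B B / 2) + (energy_form v B W + dot B B / 2)).
Proof.
move=> admU admW; have [rU eU] := admU; have [rW eW] := admW.
have fU := energy_form_flux v B rU; have fW := energy_form_flux v B rW.
have wU := fast_wave_bound p l (velocity U - v) (magnetic U - B) admU.
have wW := fast_wave_bound p l (velocity W - v) (magnetic W - B) admW.
move: fU fW wU wW; rewrite /= !energy_form_shift//.
set u := velocity U - v; set u' := velocity W - v.
set b := magnetic U - B; set b' := magnetic W - B.
have dB : magnetic W - magnetic U = b' - b by rewrite /b /b' opprB addrA subrK.
set A := pressure p U * _ + _ - _; set A' := pressure p W * _ + _ - _.
set r := density U in rU *; set r' := density W in rW *.
set e := internal_energy U in eU *; set e' := internal_energy W in eW *.
move=> fU fW wU wW.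
have {fU fW} -> : energy_form v B (flux p l U) - energy_form v B (flux p l W)
    - dot v B * (magnetic U 0 l - magnetic W 0 l) =
  (velocity U 0 l * (e + r * dot u u / 2) + A)
  - (velocity W 0 l * (e' + r' * dot u' u' / 2) + A')
  + v 0 l * (dot b b - dot b' b') / 2 by lra.
rewrite /alpha_sigma -/r -/r'.
set q := sigma * _ + _.
set M := Num.max _ _; set S := Num.sqrt (_ / r + _).
have M1 : `|velocity U 0 l| + c_speed p l U <= M by rewrite /M !le_max lexx.
have M2 : `|velocity W 0 l| + c_speed p l W <= M by rewrite /M !le_max lexx orbT.
have M0 : `|q| + Num.max (c_speed p l U) (c_speed p l W) <= M by rewrite /M le_max lexx orbT.
have M3 : `|q| + c_speed p l U <= M by apply: le_trans M0; rewrite lerD2l le_max lexx.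
have M4 : `|q| + c_speed p l W <= M by apply: le_trans M0; rewrite lerD2l le_max lexx orbT.
(* The [sigma]-average of the deviations from [v], that is, [q] minus [v_l]. *)
set rho := sigma * u 0 l + (1 - sigma) * u' 0 l.
have vE : v 0 l = q - rho by rewrite /q /rho !mxE; ring.
set D := _ / _ * S.
clearbody b b'.
have T : `|2 * (rho * (dot b b - dot b' b') / 2)| <=
    D * (r * dot u u + r' * dot u' u') + D * (dot b b + dot b' b').
  have D0 : 0 <= D by rewrite /D !mulr_ge0 ?sqrtr_ge0 ?invr_ge0 ?sqrtr_ge0.
  apply: norm_le_addr; [by apply: mulr_ge0 => //; nonneg|by apply: mulr_ge0 => //; nonneg|].
  have S2 : S ^+ 2 = sigma ^+ 2 / r + (1 - sigma) ^+ 2 / r'.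
    by rewrite sqr_sqrtr// addr_ge0// divr_ge0 ?sqr_ge0 ?ltW.
  have D2 : D ^+ 2 = dot (b' - b) (b' - b) / 2 * S ^+ 2.
    rewrite /D !exprMn enorm_sqr exprVn sqr_sqrtr//.
    by rewrite dB.
  have rho2 : rho ^+ 2 <= S ^+ 2 * (r * dot u u + r' * dot u' u').
    apply: le_trans (sqr_weighted_sum_le _ _ _ _ rU rW) _.
    rewrite S2; apply: ler_wpM2l; first by rewrite -S2 sqr_ge0.
    by apply: lerD; apply: ler_wpM2l; (exact: ltW || exact: sqr_coord_le_dot).
  have bb : (dot b b - dot b' b') ^+ 2 <=
      dot (b' - b) (b' - b) * (2 * (dot b b + dot b' b')).
    have -> : dot b b - dot b' b' = - dot (b' - b) (b' + b).
      by rewrite !dotE (dotC b' b); ring.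
    rewrite sqrrN; apply: le_trans (cauchy_schwarz _ _) _.
    apply: ler_wpM2l; first exact: dot_ge0.
    have := dot_ge0 (b' - b); rewrite !dotE (dotC b' b); lra.
  have -> : (2 * (rho * (dot b b - dot b' b') / 2)) ^+ 2 =
     rho ^+ 2 * (dot b b - dot b' b') ^+ 2 by field.
  have -> : 4 * (D * (r * dot u u + r' * dot u' u')) * (D * (dot b b + dot b' b')) =
    (S ^+ 2 * (r * dot u u + r' * dot u' u')) *
    (dot (b' - b) (b' - b) * (2 * (dot b b + dot b' b'))).
    transitivity (4 * D ^+ 2 * (r * dot u u + r' * dot u' u') * (dot b b + dot b' b')); first by ring.
    by rewrite D2; field.
  by apply: ler_pM; rewrite ?sqr_ge0.
have D0 : 0 <= D by rewrite /D !mulr_ge0 ?sqrtr_ge0 ?invr_ge0 ?sqrtr_ge0.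
have X0 : 0 <= e + r * dot u u / 2 by nonneg; rewrite invr_ge0.
have X'0 : 0 <= e' + r' * dot u' u' / 2 by nonneg; rewrite invr_ge0.
have N0 : 0 <= dot b b / 2 by nonneg; rewrite invr_ge0.
have N'0 : 0 <= dot b' b' / 2 by nonneg; rewrite invr_ge0.
have K1 := ler_wpM2r X0 M1. have K2 := ler_wpM2r X'0 M2.
have K3 := ler_wpM2r N0 M3. have K4 := ler_wpM2r N'0 M4.
have L1 := ler_wpM2r X0 (ler_norm (velocity U 0 l)).
have L2 := ler_wpM2r X'0 (ler_norm (- velocity W 0 l)).
have L3 := ler_wpM2r N0 (ler_norm q). have L4 := ler_wpM2r N'0 (ler_norm (- q)).
rewrite !normrN in L2 L4.
have De := mulr_ge0 D0 (ltW eU). have De' := mulr_ge0 D0 (ltW eW).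
rewrite vE.
move: wU wW T; rewrite !ler_norml => /andP[_ wU] /andP[wW _] /andP[T _].
lra.
Qed.

Lemma density_flux U : density (flux p l U) = density U * velocity U 0 l.
Proof. by rewrite /flux density_mk. Qed.

Lemma alpha_sigma_ge U W sigma :
  (`|velocity U 0 l| <= alpha_sigma p l U W sigma) * (`|velocity W 0 l| <= alpha_sigma p l U W sigma).
Proof.
have D0 : 0 <= enorm (magnetic W - magnetic U) / Num.sqrt 2 *
    Num.sqrt (sigma ^+ 2 / density U + (1 - sigma) ^+ 2 / density W).
  by rewrite !mulr_ge0 ?sqrtr_ge0 ?invr_ge0 ?sqrtr_ge0.
have cU := c_speed_ge0 p l U; have cW := c_speed_ge0 p l W.
by split; apply: ler_wpDr => //; rewrite !le_max ?lerDl ?cU ?cW ?orbT.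
Qed.

(** A number above the infimum exceeds some value of [alpha_sigma], so the flux estimate
    can be applied with one fixed [sigma]. *)
Lemma alpha_lt_witness U W (a : R) : alpha p l U W < a ->
  exists sigma, alpha_sigma p l U W sigma < a.
Proof.
move=> /inf_lt [|_ [sigma _ <-] sa]; last by exists sigma.
by exists (alpha_sigma p l U W 0), 0.
Qed.

Lemma energy_form_gt0 v B U : admissible U -> 0 < energy_form v B U + dot B B / 2.
Proof.
move=> [r0 e0]; rewrite energy_form_shift//.
rewrite ltr_pwDl ?divr_ge0 ?dot_ge0// ltr_pwDl// !mulr_ge0 ?dot_ge0 ?invr_ge0 ?ltW//.
Qed.

(** The states may have different normal magnetic fields, so even the sum of the two halves
    of the splitting need not be admissible. Only the defect [dot v B] times the jump
    stands in the way, and it is this linear dependence on the normal field that lets a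
    divergence constraint remove it. *)
Lemma energy_flux_splitting U W v B (a : R) :
  admissible U -> admissible W -> alpha p l U W < a ->
  energy_form v B (flux p l U) - energy_form v B (flux p l W) <
  a * ((energy_form v B U + dot B B / 2) + (energy_form v B W + dot B B / 2))
  + dot v B * (magnetic U 0 l - magnetic W 0 l).
Proof.
move=> admU admW /alpha_lt_witness[sigma sa].
rewrite -ltrBlDr; apply: le_lt_trans (flux_pair_bound v B sigma admU admW) _.
by rewrite ltr_pM2r// addr_gt0// energy_form_gt0.
Qed.

Lemma density_flux_splitting U W (a : R) :
  admissible U -> admissible W -> alpha p l U W < a ->
  density (flux p l U) - density (flux p l W) < a * (density U + density W).
Proof.
move=> [rU _] [rW _] /alpha_lt_witness[sigma sa].
have [vU vW] := alpha_sigma_ge U W sigma.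
rewrite !density_flux mulrDr; apply: ltr_leD.
  by rewrite mulrC ltr_pM2r// (le_lt_trans _ sa)// (le_trans _ vU) ?ler_norm.
rewrite -mulrN mulrC ler_pM2r//; apply: le_trans (ltW sa); apply: le_trans vW.
by rewrite -normrN ler_norm.
Qed.

Lemma speed_gt0 U W (a : R) : alpha p l U W < a -> 0 < a.
Proof.
move=> /alpha_lt_witness[sigma]; apply: le_lt_trans.
by apply: le_trans (normr_ge0 _) (alpha_sigma_ge U W sigma).1.
Qed.

End FluxPairing.

(** * The scheme seen through an affine functional *)

Section Scheme.
Variable R : realType.

Lemma weighted_sum_lt (n : nat) (w f g : 'I_n -> R) :
  (forall k, 0 <= w k) -> \sum_(k < n) w k = 1 -> (forall k, f k < g k) ->
  \sum_(k < n) w k * f k < \sum_(k < n) w k * g k.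
Proof.
move=> w0 w1 fg; rewrite -subr_gt0 -sumrB lt_def.
have wfg k : 0 <= w k * g k - w k * f k by rewrite -mulrBr mulr_ge0// subr_ge0 ltW.
rewrite sumr_ge0 ?andbT//; apply/negP => /eqP S0.
have wk0 k : w k = 0.
  have := psumr_eq0P (fun k _ => wfg k) S0 (i := k) isT.
  by move/eqP; rewrite -mulrBr mulf_eq0 subr_eq0 (gt_eqF (fg k)) orbF => /eqP.
by move: w1; rewrite big1 // => /eqP; rewrite eq_sym oner_eq0.
Qed.

(** Dropping the nonnegative contributions of all nodes but the two end ones. *)
Lemma tensor_average_ge (n m : nat) (w : 'I_n -> R) (w' : 'I_m -> R)
    (g : 'I_n -> 'I_m -> R) (i0 i1 : 'I_n) : i0 != i1 ->
  (forall k, 0 <= w k) -> (forall l, 0 <= w' l) -> (forall k l, 0 <= g k l) ->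
  w i0 = w i1 ->
  w i0 * \sum_(l < m) w' l * (g i1 l + g i0 l) <=
  \sum_(k < n) \sum_(l < m) w k * w' l * g k l.
Proof.
move=> i01 w0 w'0 g0 w01.
rewrite (bigD1 i0)//= (bigD1 i1) 1?eq_sym//= addrA -big_split/= mulr_sumr.
rewrite ler_wpDr//; last first.
  by apply: ler_sum => l _; rewrite -w01; lra.
by apply: sumr_ge0 => k _; apply: sumr_ge0 => l _; rewrite !mulr_ge0.
Qed.

Section Functional.
Variables (p : R -> R -> R) (f : {scalar state R}) (c kappa : R).
Let T U := f U + c.

(** For [f U + c] the density or a shifted energy form, this is the positivity of the
    sum of the two Lax-Friedrichs halves [U - F(U)/a] and [W + F(W)/a], up to a defect
    proportional to the jump of the normal magnetic field; [kappa] is the factor of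
    proportionality. *)
Definition flux_splitting (l : 'I_3) (a : R) (U W : state R) : Prop :=
  f (flux p l U) - f (flux p l W) <
    a * ((f U + c) + (f W + c)) + kappa * (magnetic U 0 l - magnetic W 0 l).

(** Of the two traces on each face, [Um] and [Up'] are taken from inside the cell. So
    the pairs [Um, Um'] and [Up, Up'] match the inner trace of one face with the outer
    trace of the opposite face. In the sum of their two bounds, the dissipation of the
    fluxes cancels the outer traces and doubles the inner ones. *)
Lemma lf_flux_difference (l : 'I_3) (a : R) (Um Up Um' Up' : state R) :
  flux_splitting l a Um Um' -> flux_splitting l a Up Up' ->
  f (lf_flux p l a Um Up - lf_flux p l a Um' Up') <
    a * (T Um + T Up') + kappa * (mean_B l Um Up - mean_B l Um' Up').
Proof.
rewrite /flux_splitting /T /mean_B /lf_flux !(linearB f, linearD f, scalarZ f).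
by move=> Hm Hp; rewrite -subr_gt0; lra.
Qed.

Lemma flux_balance_lt (Q : nat) (w : 'I_Q -> R) (l : 'I_3) (a : R)
    (Um Up Um' Up' : 'I_Q -> state R) :
  (forall k, 0 <= w k) -> \sum_(k < Q) w k = 1 ->
  (forall k, flux_splitting l a (Um k) (Um' k)) ->
  (forall k, flux_splitting l a (Up k) (Up' k)) ->
  f (\sum_(k < Q) w k *: (lf_flux p l a (Um k) (Up k) - lf_flux p l a (Um' k) (Up' k))) <
  a * (\sum_(k < Q) w k * (T (Um k) + T (Up' k)))
  + kappa * \sum_(k < Q) w k * (mean_B l (Um k) (Up k) - mean_B l (Um' k) (Up' k)).
Proof.
move=> w0 w1 Hm Hp; rewrite linear_sum !mulr_sumr -big_split/=.
under eq_bigr do rewrite linearZ/=.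
under [ltRHS]eq_bigr do rewrite mulrCA [X in _ + X]mulrCA -mulrDr.
by apply: weighted_sum_lt => // k; apply: lf_flux_difference.
Qed.

(** Summing the face estimates, the magnetic defects add up to [kappa * dt] times the
    discrete divergence, hence vanish, and the numerical dissipation costs
    [lx * X + ly * Y], where [X] and [Y] are the weighted sums of the inner traces on the
    two pairs of faces. The cell average dominates [w0 * X] and [w0 * Y], hence their mean
    with weights proportional to [lx] and [ly], and the CFL condition makes [w0]
    at least [lx + ly]. *)
Lemma next_average_gt0 (Q : nat) (dt dx dy a1 a2 w0 : R) (w : 'I_Q -> R)
    (Ubar : int -> int -> state R) (Uxm Uxp Uym Uyp : int -> int -> 'I_Q -> state R) i j :
  (forall k, 0 <= w k) -> \sum_(k < Q) w k = 1 ->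
  0 < dx -> 0 < dy -> 0 < dt -> 0 < a1 -> 0 < a2 ->
  a1 * dt / dx + a2 * dt / dy <= w0 ->
  discrete_div dx dy w Uxm Uxp Uym Uyp i j = 0 ->
  (forall k, flux_splitting 0 a1 (Uxm i j k) (Uxm (i - 1) j k)) ->
  (forall k, flux_splitting 0 a1 (Uxp i j k) (Uxp (i - 1) j k)) ->
  (forall k, flux_splitting 1 a2 (Uym i j k) (Uym i (j - 1) k)) ->
  (forall k, flux_splitting 1 a2 (Uyp i j k) (Uyp i (j - 1) k)) ->
  (forall k, 0 <= T (Uxm i j k) + T (Uxp (i - 1) j k)) ->
  (forall k, 0 <= T (Uym i j k) + T (Uyp i (j - 1) k)) ->
  w0 * (\sum_(k < Q) w k * (T (Uxm i j k) + T (Uxp (i - 1) j k))) <= T (Ubar i j) ->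
  w0 * (\sum_(k < Q) w k * (T (Uym i j k) + T (Uyp i (j - 1) k))) <= T (Ubar i j) ->
  0 < T (next_average p dt dx dy a1 a2 w Ubar Uxm Uxp Uym Uyp i j).
Proof.
move=> wge0 w1 dx0 dy0 dt0 a10 a20 cfl div0 Hxm Hxp Hym Hyp Tx Ty.
have Fx := flux_balance_lt wge0 w1 Hxm Hxp; have Fy := flux_balance_lt wge0 w1 Hym Hyp.
set X := (\sum_(k < Q) w k * (T (Uxm i j k) + _)) in Fx *.
set Y := (\sum_(k < Q) w k * (T (Uym i j k) + _)) in Fy *.
have X0 : 0 <= X by apply: sumr_ge0 => k _; rewrite mulr_ge0.
have Y0 : 0 <= Y by apply: sumr_ge0 => k _; rewrite mulr_ge0.
move=> UX UY.
rewrite /T /next_average !(linearB f) !scalarZ.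
move: div0 Fx Fy; rewrite /discrete_div.
set Dx := (\sum_(k < Q) _); set Dy := (\sum_(k < Q) w k * (mean_B 1 _ _ - _)) => div0.
set Gx := f _ => Fx; set Gy := f _ => Fy.
have dtdx : 0 < dt / dx by rewrite divr_gt0.
have dtdy : 0 < dt / dy by rewrite divr_gt0.
have Fx' : dt / dx * Gx < dt / dx * (a1 * X + kappa * Dx) by rewrite ltr_pM2l.
have Fy' : dt / dy * Gy < dt / dy * (a2 * Y + kappa * Dy) by rewrite ltr_pM2l.
set lx := a1 * dt / dx in cfl; set ly := a2 * dt / dy in cfl.
have lx0 : 0 < lx by rewrite /lx !mulr_gt0// invr_gt0.
have ly0 : 0 < ly by rewrite /ly !mulr_gt0// invr_gt0.
have lxy0 : 0 < lx + ly by rewrite addr_gt0.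
have Ubound : lx * X + ly * Y <= T (Ubar i j).
  have UX' : (lx + ly) * X <= T (Ubar i j).
    by apply: le_trans UX; rewrite ler_wpM2r.
  have UY' : (lx + ly) * Y <= T (Ubar i j).
    by apply: le_trans UY; rewrite ler_wpM2r.
  rewrite -(ler_pM2l lxy0).
  have := ler_wpM2l (ltW lx0) UX'; have := ler_wpM2l (ltW ly0) UY'; nra.
have kdiv : kappa * dt * (Dx / dx + Dy / dy) = 0 by rewrite div0 mulr0.
have EX : dt / dx * (a1 * X + kappa * Dx) + dt / dy * (a2 * Y + kappa * Dy) =
   lx * X + ly * Y + kappa * dt * (Dx / dx + Dy / dy).
  by rewrite /lx /ly; field; rewrite !gt_eqF.
have := ltrD Fx' Fy'; rewrite EX kdiv addr0 => FxFy.
have := lt_le_trans FxFy Ubound; rewrite -subr_gt0 => H.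
apply: lt_le_trans H _; rewrite le_eqVlt; apply/orP; left; apply/eqP.
rewrite /T; ring.
Qed.
End Functional.
End Scheme.

(** * Interface traces inside the cell average *)

Section CellAverageBound.
Variables (R : realType) (f : {scalar state R}) (e : R).
Let T U := f U + e.

(** The weights sum to one, so the additive constant is averaged along with [f]. *)
Lemma affine_cell_average K n m (a b c d : R) (x w : 'I_n -> R) (y w' : 'I_m -> R)
    (P : poly_state R) :
  (forall q : {poly R}, (size q <= K.+1)%N ->
     average a b (horner q) = \sum_(k < n) w k * q.[x k]) ->
  (forall q : {poly R}, (size q <= K.+1)%N ->
     average c d (horner q) = \sum_(l < m) w' l * q.[y l]) ->
  (forall k, degree_le K (P 0 k)) ->
  \sum_(k < n) w k = 1 -> \sum_(l < m) w' l = 1 ->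
  T (cell_average P a b c d) =
    \sum_(k < n) \sum_(l < m) w k * w' l * T (eval_state P (x k) (y l)).
Proof.
move=> exact_x exact_y degP w1 w'1.
rewrite /T (cell_average_quadrature exact_x exact_y degP) linear_sum.
have {1}-> : e = \sum_(k < n) \sum_(l < m) w k * w' l * e.
  rewrite -[LHS]mul1r -w1 mulr_suml; apply: eq_bigr => k _.
  by rewrite -mulr_suml -mulr_sumr w'1 mulr1.
rewrite -big_split; apply: eq_bigr => k _; rewrite linear_sum -big_split.
by apply: eq_bigr => l _; rewrite scalarZ mulrDr.
Qed.

Variables (K Q L : nat) (a b c d : R).
Hypotheses (ab : a < b) (cd : c < d) (KQ : (K + 1 <= 2 * Q)%N) (KL : (K + 3 <= 2 * L)%N).
Variables (P : poly_state R) (w : 'I_Q -> R) (wl : 'I_L -> R) (nu1 : 'I_L).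
Hypotheses (degP : forall k, degree_le K (P 0 k)) (nu10 : nu1 = 0%N :> nat).

Lemma cell_average_ge_x (x : 'I_L -> R) (y : 'I_Q -> R) :
  gauss_lobatto_rule a b x wl -> gauss_rule c d y w ->
  (forall k l, 0 <= T (eval_state P (x k) (y l))) ->
  wl nu1 * (\sum_(l < Q) w l * (T (eval_state P b (y l)) + T (eval_state P a (y l)))) <=
  T (cell_average P a b c d).
Proof.
move=> ruleL ruleG T0.
have Q0 : (0 < Q)%N by lia.
have [_ [nu2 [_ xb _]]] := gauss_lobatto_ends ab ruleL.
have xa := gauss_lobatto_first ruleL nu10.
have nu12 : nu1 != nu2.
  by apply: contraTN ab => /eqP nu12; rewrite -xa -xb nu12 ltxx.
rewrite (@affine_cell_average K L Q a b c d x wl y w)//.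
- rewrite -xa -xb; apply: (tensor_average_ge nu12) => //.
  + by move=> k; exact: (gauss_lobatto_weight_ge0 ab ruleL).
  + by move=> l; exact: (gauss_weight_ge0 _ cd ruleG).
  + exact: (gauss_lobatto_end_weights ab ruleL xa xb).
- by case: ruleL => _ _ _ exact_rule q sq; apply: exact_rule; lia.
- by case: ruleG => _ _ exact_rule q sq; apply: exact_rule; lia.
- exact: gauss_lobatto_weight_sum ab ruleL.
- exact: gauss_weight_sum Q0 cd ruleG.
Qed.

Lemma cell_average_ge_y (x : 'I_Q -> R) (y : 'I_L -> R) :
  gauss_rule a b x w -> gauss_lobatto_rule c d y wl ->
  (forall k l, 0 <= T (eval_state P (x k) (y l))) ->
  wl nu1 * (\sum_(k < Q) w k * (T (eval_state P (x k) d) + T (eval_state P (x k) c))) <=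
  T (cell_average P a b c d).
Proof.
move=> ruleG ruleL T0.
have Q0 : (0 < Q)%N by lia.
have [_ [nu2 [_ yd _]]] := gauss_lobatto_ends cd ruleL.
have yc := gauss_lobatto_first ruleL nu10.
have nu12 : nu1 != nu2.
  by apply: contraTN cd => /eqP nu12; rewrite -yc -yd nu12 ltxx.
rewrite (@affine_cell_average K Q L a b c d x w y wl)//.
- rewrite exchange_big /=; under [leRHS]eq_bigr => l _ do under eq_bigr do rewrite (mulrC (w _)).
  rewrite -yc -yd.
  apply: (@tensor_average_ge _ _ _ wl w (fun l k => T (eval_state P (x k) (y l))) _ _ nu12) => //.
  + by move=> k; exact: (gauss_lobatto_weight_ge0 cd ruleL).
  + by move=> l; exact: (gauss_weight_ge0 _ ab ruleG).
  + exact: (gauss_lobatto_end_weights cd ruleL yc yd).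
- by case: ruleG => _ _ exact_rule q sq; apply: exact_rule; lia.
- by case: ruleL => _ _ _ exact_rule q sq; apply: exact_rule; lia.
- exact: gauss_weight_sum Q0 ab ruleG.
- exact: gauss_lobatto_weight_sum cd ruleL.
Qed.

End CellAverageBound.

(** * Positivity of the updated averages *)

Theorem theorem4p7 (R : realType) (p : R -> R -> R) (K Q L : nat)
    (dx dy dt a1 a2 : R) (xf yf : int -> R)
    (xg yg : int -> 'I_Q -> R) (w : 'I_Q -> R)
    (xl yl : int -> 'I_L -> R) (wl : 'I_L -> R) (nu1 : 'I_L)
    (P : int -> int -> poly_state R) (Ubar : int -> int -> state R) :
  let Uxm := trace_x_minus P xf yg in
  let Uxp := trace_x_plus P xf yg in
  let Uym := trace_y_minus P yf xg in
  let Uyp := trace_y_plus P yf xg in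
  equation_of_state p ->
  0 < dx -> 0 < dy ->
  (forall i, xf i - xf (i - 1) = dx) ->
  (forall j, yf j - yf (j - 1) = dy) ->
  (K + 1 <= 2 * Q)%N ->
  (forall i, gauss_rule (xf (i - 1)) (xf i) (xg i) w) ->
  (forall j, gauss_rule (yf (j - 1)) (yf j) (yg j) w) ->
  (K + 3 <= 2 * L)%N ->
  (forall i, gauss_lobatto_rule (xf (i - 1)) (xf i) (xl i) wl) ->
  (forall j, gauss_lobatto_rule (yf (j - 1)) (yf j) (yl j) wl) ->
  nu1 = 0%N :> nat ->
  (forall i j k, degree_le K (P i j 0 k)) ->
  (forall i j, Ubar i j = cell_average (P i j) (xf (i - 1)) (xf i) (yf (j - 1)) (yf j)) ->
  (forall i j, discrete_div dx dy w Uxm Uxp Uym Uyp i j = 0) ->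
  (forall i j (mu : 'I_Q) (nu : 'I_L),
     admissible (eval_state (P i j) (xl i nu) (yg j mu)) /\
     admissible (eval_state (P i j) (xg i mu) (yl j nu))) ->
  (sup_alpha_x p Uxm < a1%:E)%E -> (sup_alpha_x p Uxp < a1%:E)%E ->
  (sup_alpha_y p Uym < a2%:E)%E -> (sup_alpha_y p Uyp < a2%:E)%E ->
  0 < a1 * dt / dx + a2 * dt / dy <= wl nu1 ->
  forall i j, admissible (next_average p dt dx dy a1 a2 w Ubar Uxm Uxp Uym Uyp i j).
Proof.
move=> Uxm Uxp Uym Uyp _ dx0 dy0 dxE dyE KQ gaussx gaussy KL lobx loby nu10 degP UbarE
  div0 admP axm axp aym ayp /andP[cfl_gt0 cfl] i j.
have xlt i' : xf (i' - 1) < xf i' by rewrite -subr_gt0 dxE.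
have ylt j' : yf (j' - 1) < yf j' by rewrite -subr_gt0 dyE.
have xright i' : exists nu, xl i' nu = xf i' by case: (lobx i') => _ _ [? ?] _.
have xleft i' : exists nu, xl i' nu = xf (i' - 1) by case: (lobx i') => _ _ [? ?] _.
have yright j' : exists nu, yl j' nu = yf j' by case: (loby j') => _ _ [? ?] _.
have yleft j' : exists nu, yl j' nu = yf (j' - 1) by case: (loby j') => _ _ [? ?] _.
have admxm i' j' k : admissible (Uxm i' j' k).
  by rewrite /Uxm /trace_x_minus; have [nu <-] := xright i'; exact: (admP i' j' k nu).1.
have admxp i' j' k : admissible (Uxp i' j' k).
  rewrite /Uxp /trace_x_plus; have [nu] := xleft (i' + 1); rewrite addrK => <-.
  exact: (admP (i' + 1) j' k nu).1.
have admym i' j' k : admissible (Uym i' j' k).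
  by rewrite /Uym /trace_y_minus; have [nu <-] := yright j'; exact: (admP i' j' k nu).2.
have admyp i' j' k : admissible (Uyp i' j' k).
  rewrite /Uyp /trace_y_plus; have [nu] := yleft (j' + 1); rewrite addrK => <-.
  exact: (admP i' (j' + 1) k nu).2.
have sup_x (V : int -> int -> 'I_Q -> state R) : (sup_alpha_x p V < a1%:E)%E ->
    forall i' j' k, alpha p 0 (V i' j' k) (V (i' - 1) j' k) < a1.
  move=> V_lt i' j' k; rewrite -lte_fin; apply: le_lt_trans V_lt.
  by apply: ereal_sup_ubound; exists (i', j', k).
have sup_y (V : int -> int -> 'I_Q -> state R) : (sup_alpha_y p V < a2%:E)%E ->
    forall i' j' k, alpha p 1 (V i' j' k) (V i' (j' - 1) k) < a2.
  move=> V_lt i' j' k; rewrite -lte_fin; apply: le_lt_trans V_lt.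
  by apply: ereal_sup_ubound; exists (i', j', k).
have k0 : 'I_Q by apply: (@Ordinal _ 0); lia.
have a10 := speed_gt0 (sup_x _ axm i j k0).
have a20 := speed_gt0 (sup_y _ aym i j k0).
have dt0 : 0 < dt.
  have s0 : 0 < a1 / dx + a2 / dy by rewrite addr_gt0 ?divr_gt0.
  by rewrite -(pmulr_rgt0 _ s0) mulrDl !(mulrAC _ _ dt).
have w0 k : 0 <= w k by exact: gauss_weight_ge0 (xlt i) (gaussx i).
have w1 : \sum_(k < Q) w k = 1.
  by apply: gauss_weight_sum (xlt i) (gaussx i); lia.
(* The whole update is linear in the fluxes, so each affine constraint that has a
   flux splitting is preserved. *)
have positive (f : {scalar state R}) (e kappa : R) :
  (forall U, admissible U -> 0 < f U + e) ->
  (forall (l : 'I_3) a U W, admissible U -> admissible W -> alpha p l U W < a ->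
    flux_splitting p f e kappa l a U W) ->
  0 < f (next_average p dt dx dy a1 a2 w Ubar Uxm Uxp Uym Uyp i j) + e.
  move=> f_pos f_flux.
  apply: (@next_average_gt0 R p f e kappa Q dt dx dy a1 a2 (wl nu1)) => //.
  - by move=> k; apply: f_flux => //; exact: sup_x.
  - by move=> k; apply: f_flux => //; exact: sup_x.
  - by move=> k; apply: f_flux => //; exact: sup_y.
  - by move=> k; apply: f_flux => //; exact: sup_y.
  - by move=> k; rewrite addr_ge0 ?ltW ?f_pos.
  - by move=> k; rewrite addr_ge0 ?ltW ?f_pos.
  - rewrite UbarE /Uxm /Uxp /trace_x_minus /trace_x_plus subrK.
    apply: (cell_average_ge_x (f := f) (xlt i) (ylt j) KQ KL _ _ (lobx i) (gaussy j)) => //.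
    by move=> nu mu; apply/ltW/f_pos; exact: (admP i j mu nu).1.
  - rewrite UbarE /Uym /Uyp /trace_y_minus /trace_y_plus subrK.
    apply: (cell_average_ge_y (f := f) (xlt i) (ylt j) KQ KL _ _ (gaussx i) (loby j)) => //.
    by move=> mu nu; apply/ltW/f_pos; exact: (admP i j mu nu).2.
set V := next_average _ _ _ _ _ _ _ _ _ _ _ _ _ _ in positive *.
have rV : 0 < density V.
  rewrite -[density V]addr0; apply: (positive (@density R) 0 0) => [U [rU _]|l a U W aU aW lta].
    by rewrite addr0.
  by rewrite /flux_splitting !addr0 mul0r addr0; exact: density_flux_splitting.
split=> //.
(* Testing with the velocity and the magnetic field of the new state itself makes
   the shifted energy form equal to its internal energy. *)
have := positive (energy_form (velocity V) (magnetic V))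
  (dot (magnetic V) (magnetic V) / 2) (dot (velocity V) (magnetic V)).
rewrite (energy_form_shift _ _ rV) !subrr.
have dot0 : dot (0 : 'rV[R]_3) 0 = 0 by rewrite -(scale0r 0) dotZl mul0r.
rewrite dot0 mulr0 mul0r !addr0; apply.
  by move=> U; exact: energy_form_gt0.
by move=> l a U W; exact: energy_flux_splitting.
Qed.
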